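(* Let $X$ be a finite CW complex with oriented cells, $d\ge 1$, $z_d=\dim Z_d(X;\mathbb Q)$, and let $V_0\subset S_d$ be a $d$-dimensional spanning forest of $X$. Let $\{z(\sigma)\mid\sigma\in S_d\setminus V_0\}$ be the associated geometric basis of $Z_d(X;\mathbb Q)$, and let $M=(\langle z(\sigma),z(\sigma')\rangle)_{\sigma,\sigma'\in S_d\setminus V_0}$ be its cycle mesh matrix. Then $M$ is a $z_d\times z_d$ matrix, and the coefficient of $(-1)^kt^{z_d-k}$ in its characteristic polynomial $\det(t\,\mathrm{Id}-M)$ is the $k$-th elementary symmetric function of its eigenvalues, called $\sigma_k(V_0)$. Moreover, there is a direct combinatorial formula for this coefficient: $$\sigma_k(V_0)=\sum_{U\subset S_d\setminus V_0,\ |U|=k}\ \left(\ \sum_{V\ \text{a spanning forest in } X_{V_0}}\left(\frac{t_{d-1}(X_V)}{t_{d-1}(X_{V_0\cup U})}\right)^2\right).$$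
   Context: $C_i$, $Z_i$, $B_i$ are cellular chains, cycles and boundaries; $S_d$ is the set of oriented $d$-cells of $X$; $\langle\cdot,\cdot\rangle$ is the bilinear pairing on $C_d(X;\mathbb Q)$ for which the $d$-cells are orthonormal. For $V\subset S_d$, $X_V=X^{(d-1)}\cup V$ is the union of the $(d-1)$-skeleton of $X$ and the cells of $V$. $t_i(Y)$ is the order of the torsion subgroup of $H_i(Y;\mathbb Z)$. A $d$-dimensional spanning forest of a complex $Y$ is a set $V$ of $d$-cells of $Y$ with $|V|=\operatorname{rank}B_{d-1}(Y;\mathbb Z)$ and $Z_d(Y^{(d-1)}\cup V;\mathbb R)=0$. Given the spanning forest $V_0$ of $X$, for each $\sigma\in S_d\setminus V_0$, $z(\sigma)$ is the unique rational $d$-cycle in $Z_d(X_{V_0\cup\{\sigma\}};\mathbb Q)$ whose coefficient on $\sigma$ is $+1$; these cycles form a basis of $Z_d(X;\mathbb Q)$.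
   Formalization: The printed formula is false (triangle graph, d=1, k=1: σ_1=3 but it gives 1); the two subscripts are interchanged: V ranges over spanning forests in X_{V_0∪U}, and the ratio is t_{d-1}(X_V)/t_{d-1}(X_{V_0}). *)

(* Defs.v *)
From HB Require Import structures.
From mathcomp Require Import all_boot all_order all_algebra all_field.
From mathcomp Require Import complex finmap.
From mathcomp Require Import boolp classical_sets functions cardinality filter.
From mathcomp Require Import reals topology normedtype.

Set Implicit Arguments.
Unset Strict Implicit.
Unset Printing Implicit Defensive.

Import Order.TTheory GRing.Theory Num.Theory.
Import numFieldNormedType.Exports.
Local Open Scope classical_set_scope.
Local Open Scope ring_scope.

Section Spheres.
Variable R : realType.

Definition sqnorm n (x : 'rV[R]_n) : R := \sum_i x 0 i ^+ 2.

Definition disc n : set 'rV[R]_n := [set x | sqnorm x <= 1]%classic.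

Definition odisc n : set 'rV[R]_n := [set x | sqnorm x < 1]%classic.

(* [sphere n] is the unit sphere S^(n-1) of R^n; it is empty for n = 0. *)
Definition sphere n : set 'rV[R]_n := [set x | sqnorm x = 1]%classic.

Definition sphere_homotopic n (f g : 'rV[R]_n -> 'rV[R]_n) : Prop :=
  exists H : R * 'rV[R]_n -> 'rV[R]_n,
    [/\ {within [set u | 0 <= u.1 <= 1 /\ sphere u.2]%classic, continuous H},
        forall s x, 0 <= s <= 1 -> sphere x -> sphere (H (s, x)),
        forall x, sphere x -> H (0, x) = f x &
        forall x, sphere x -> H (1, x) = g x].

(* The standard self-map of degree k of S^(n+1): with the first two coordinates
   read as the complex number r e^(i a), it sends r e^(i a) to r e^(i k a) and
   leaves the other coordinates unchanged, i.e. it is an iterated suspension of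
   z |-> z^k on the circle. *)
Definition winding n (k : int) (x : 'rV[R]_n.+2) : 'rV[R]_n.+2 :=
  let w : R[i] := (x 0 ord0 +i* x 0 (lift ord0 ord0))%C in
  let v : R[i] := `|w| * (w / `|w|) ^ k in
  \row_i match val i with
         | 0%N => complex.Re v
         | 1%N => complex.Im v
         | _ => x 0 i
         end.

(* [has_degree f k]: the self-map f of S^n, seen inside R^(n+1), has degree k.
   For n > 0 this means that f is homotopic to the standard map of degree k,
   and such a k exists and is unique for every continuous f (Hopf).  For
   n = 0 it is the action of f on reduced homology: 1 for the identity of
   {-1, 1}, -1 for the swap, 0 for a constant map. *)
Definition has_degree n : ('rV[R]_n.+1 -> 'rV[R]_n.+1) -> int -> Prop :=
  match n with
  | 0%N => fun f k => f (const_mx 1) 0 0 - f (const_mx (-1)) 0 0 = k%:~R *+ 2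
  | m.+1 => fun f k => sphere_homotopic f (@winding m k)
  end.

(* [pinch] maps the open disc of R^n homeomorphically onto S^n minus the point
   [pinch_base], and maps the whole boundary of the disc to [pinch_base]. *)
Definition pinch n (y : 'rV[R]_n) : 'rV[R]_n.+1 :=
  row_mx (1 - sqnorm y *+ 2)%:M ((Num.sqrt (1 - sqnorm y) *+ 2) *: y).

Definition pinch_base n : 'rV[R]_n.+1 := row_mx (-1)%:M (0 : 'rV[R]_n).

(* For a characteristic map Phi of an n-cell e, the collapse X^n -> S^n of the
   complement of e: it is the composite X^n -> X^n / (X^n - e) = D^n / S^(n-1)
   = S^n, where the last identification is [pinch]. *)
Definition collapse n (T : Type) (Phi : 'rV[R]_n -> T) (p : T) : 'rV[R]_n.+1 :=
  match pselect (exists2 y, odisc y & Phi y = p) with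
  | left e => pinch (projT1 (cid2 e))
  | right _ => pinch_base n
  end.

End Spheres.

(* The cells are oriented by their characteristic maps, whose sources carry the
   standard orientation.  Since there are finitely many cells, the weak topology
   is automatic; likewise, a characteristic map that is continuous on the closed
   disc and injective on the open one is a homeomorphism from the open disc onto
   the open cell.

   [incidence] is the matrix of the cellular boundary map,
     boundary sigma = \sum_tau incidence sigma tau * tau,
   where the coefficient is the degree of
     S^(n-1) -> X^(n-1) -> X^(n-1) / (X^(n-1) - tau) = S^(n-1),
   the attaching map of sigma followed by the collapse onto tau.  This degree
   exists and is unique, so [incidence] is determined by the other data, and
   [incidence_incidence] (boundary o boundary = 0) holds for every such
   complex; both are recorded here because neither degree theory nor
   the homology of CW pairs is available in the libraries. *)
Record finite_CW (R : realType) := FiniteCW {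
  space : topologicalType;
  space_hausdorff : hausdorff_space space;
  cell : finType;
  dim : cell -> nat;
  char_map : forall s : cell, 'rV[R]_(dim s) -> space;
  char_map_continuous : forall s,
    {within @disc R (dim s), continuous (@char_map s)};
  char_map_inj : forall s x y,
    odisc x -> odisc y -> @char_map s x = @char_map s y -> x = y;
  cells_cover : forall p : space,
    exists s : cell, exists2 x, odisc x & @char_map s x = p;
  cells_disjoint : forall (s t : cell) x y,
    odisc x -> odisc y -> @char_map s x = @char_map t y -> s = t;
  char_map_boundary : forall (s : cell) x, sphere x ->
    exists2 t : cell, (dim t < dim s)%N &
      exists2 y, odisc y & @char_map t y = @char_map s x;
  incidence : cell -> cell -> int;
  incidence_dim : forall s t, dim s != (dim t).+1 -> incidence s t = 0;
  incidence_degree : forall (s t : cell) (e : (dim t).+1 = dim s),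
    has_degree (fun x : 'rV[R]_(dim t).+1 =>
                  collapse (@char_map t) (@char_map s (castmx (erefl, e) x)))
               (incidence s t);
  incidence_incidence : forall s u,
    \sum_t incidence s t * incidence t u = 0
}.

(* A subcomplex Y of X is given by its set of cells, and its i-chains are the
   functions on the cells of X that vanish off the i-cells of Y. *)

Section Cellular.
Variables (R : realType) (X : finite_CW R).

Definition cells (i : nat) : {set cell X} := [set s | dim s == i].

Definition skeleton (i : nat) (Y : {set cell X}) : {set cell X} :=
  [set s in Y | (dim s <= i)%N].

Definition chain (K : nzRingType) := {ffun cell X -> K^o}.

Definition cell_chain (K : nzRingType) (s : cell X) : chain K :=
  [ffun t => (t == s)%:R].

Definition boundary (K : nzRingType) (c : chain K) : chain K :=
  [ffun t => \sum_s c s * (incidence s t)%:~R].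

Fact boundary_is_linear (K : nzRingType) : linear (@boundary K).
Proof.
move=> a b c; apply/ffunP => t; rewrite !ffunE scaler_sumr -big_split /=.
by apply: eq_bigr => s _; rewrite !ffunE mulrDl scalerAl.
Qed.

HB.instance Definition _ (K : nzRingType) :=
  GRing.isLinear.Build K (chain K) (chain K) *:%R (@boundary K)
    (@boundary_is_linear K).

Definition pairing (K : nzRingType) (a b : chain K) : K := \sum_s a s * b s.

Section FieldCoefficients.
Variable K : fieldType.

Definition chains (i : nat) (Y : {set cell X}) : {vspace chain K} :=
  <<[seq cell_chain K s | s in (Y :&: cells i)%SET]>>%VS.

Definition cycles (i : nat) (Y : {set cell X}) : {vspace chain K} :=
  (chains i Y :&: lker (linfun (@boundary K)))%VS.

Definition boundaries (i : nat) (Y : {set cell X}) : {vspace chain K} :=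
  (linfun (@boundary K) @: chains i.+1 Y)%VS.

End FieldCoefficients.

Section IntegerCoefficients.

Definition int_chains (i : nat) (Y : {set cell X}) : set (chain int) :=
  [set c | forall s, s \notin Y :&: cells i -> c s = 0].

Definition int_cycles (i : nat) (Y : {set cell X}) : set (chain int) :=
  int_chains i Y `&` [set c | boundary c = 0].

Definition int_boundaries (i : nat) (Y : {set cell X}) : set (chain int) :=
  @boundary int @` int_chains i.+1 Y.

Definition homology_class (i : nat) (Y : {set cell X}) (c : chain int) :
    set (chain int) :=
  [set c' | int_cycles i Y c' /\ int_boundaries i Y (c' - c)].

Definition torsion_homology (i : nat) (Y : {set cell X}) :
    set (set (chain int)) :=
  [set homology_class i Y c | c in
    [set c | int_cycles i Y c /\
             exists2 m : nat, (0 < m)%N & int_boundaries i Y (c *+ m)]].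

(* The order t_i(Y) of the torsion subgroup of H_i(Y; Z); this group is finite,
   so the default value of [fset_set] on infinite sets plays no role. *)
Definition torsion_order (i : nat) (Y : {set cell X}) : nat :=
  #|` fset_set (torsion_homology i Y)|%fset.

End IntegerCoefficients.

(* rank B_i(Y; Z), i.e. the dimension of its rational span B_i(Y; Q). *)
Definition rank_boundaries (i : nat) (Y : {set cell X}) : nat :=
  \dim (boundaries rat i Y).

Definition spanning_forest (d : nat) (Y V : {set cell X}) : bool :=
  [&& V \subset Y :&: cells d,
      #|V| == rank_boundaries d.-1 Y &
      cycles R d (skeleton d.-1 Y :|: V) == 0%VS].

(* X_V, for V a set of d-cells and d > 0. *)
Definition subcomplex (d : nat) (V : {set cell X}) : {set cell X} :=
  skeleton d.-1 [set: cell X] :|: V.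

Definition cycle_dim (d : nat) : nat := \dim (cycles rat d [set: cell X]).

(* When V0 is a spanning forest and s is a d-cell outside V0, exactly one chain
   satisfies this description; 0 is the default value of [xget]. *)
Definition geometric_cycle (d : nat) (V0 : {set cell X}) (s : cell X) :
    chain rat :=
  xget 0 [set z : chain rat |
    z \in cycles rat d (subcomplex d (V0 :|: [set s])) /\ z s = 1]%classic.

Definition mesh_matrix (d : nat) (V0 : {set cell X}) :
    'M[rat]_#|cells d :\: V0| :=
  \matrix_(i, j) pairing (geometric_cycle d V0 (enum_val i))
                         (geometric_cycle d V0 (enum_val j)).

End Cellular.

(* The complex eigenvalues of M, repeated with their algebraic multiplicities. *)
Definition eigenvalues (n : nat) (M : 'M[rat]_n) : seq algC :=
  sval (closed_field_poly_normal
          (map_poly (ratr : rat -> algC) (char_poly M))).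

Definition elem_sym (K : comNzRingType) (k : nat) (s : seq K) : K :=
  \sum_(I : {set 'I_(size s)} | #|I| == k) \prod_(i in I) s`_i.

Definition mesh_sigma (R : realType) (X : finite_CW R) (d k : nat)
    (V0 : {set cell X}) : algC :=
  elem_sym k (eigenvalues (mesh_matrix d V0)).

(* Main.v *)
(** Write the boundary of a d-cell s as the combination of the boundaries of the
    cells of V0 with coefficient vector g_s in Q^r.  Then z(s) = s - g_s, so
    M = 1 + A A^T where A has the rows g_s for s outside V0.  The minor of M on U is
    det (1 + A_U A_U^T) = det (1 + A_U^T A_U), which is the Gram determinant of
    the vectors g_s, s in V0 :|: U (the cells of V0 give the identity).  By
    Cauchy-Binet it is the sum of det (g_V)^2 over the r-element subsets V of
    V0 :|: U.  The terms with nonzero determinant are those where V is a spanning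
    forest, and there |det (g_V)| is the index of the lattice spanned by the
    boundaries of V divided by the index for V0, both inside the common saturated
    lattice, that is, a ratio of torsion orders. *)
Require Import Defs.
From mathcomp Require Import classical_sets cardinality reals.
From mathcomp Require Import all_boot all_order all_fingroup all_algebra all_field.
From mathcomp Require Import finmap zify.

Set Implicit Arguments.
Unset Strict Implicit.
Unset Printing Implicit Defensive.

Import Order.TTheory GRing.Theory Num.Theory.
Local Open Scope ring_scope.

(** * Determinants of sums, and Cauchy-Binet *)

Section Determinants.
Variable K : comNzRingType.

(** Multilinearity in the rows: [J] records the rows taken from [A]. *)
Lemma det_addmx n (A B : 'M[K]_n) :
  \det (A + B)
    = \sum_(J : {set 'I_n}) \det (\matrix_(i, j) if i \in J then A i j else B i j).
Proof.
rewrite /determinant exchange_big /=; apply: eq_bigr => s _.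
rewrite -big_distrr /=; congr (_ * _).
under eq_bigr do rewrite mxE.
rewrite bigA_distr; apply: eq_bigr => J _; apply: eq_bigr => i _.
by rewrite mxE; case: ifP.
Qed.

(* Both sides are Schur complements of the block matrix [[1, -B], [A, 1]]. *)
Lemma det_add1_mulmx m n (A : 'M[K]_(m, n)) (B : 'M[K]_(n, m)) :
  \det (1%:M + A *m B) = \det (1%:M + B *m A).
Proof.
have Hl : block_mx 1%:M (- B) A 1%:M
    = block_mx (1%:M : 'M_n) 0 A 1%:M *m block_mx 1%:M (- B) 0 (1%:M + A *m B).
  by rewrite mulmx_block !mul1mx !mul0mx !mulmx1 !addr0 mulmxN addrC addrK.
have Hr : block_mx 1%:M (- B) A 1%:M
    = block_mx (1%:M : 'M_n) (- B) 0 1%:M *m block_mx (1%:M + B *m A) 0 A 1%:M.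
  by rewrite mulmx_block !mul1mx !mul0mx !mulmx1 !add0r ?mulmx0 mulNmx addrK.
have := congr1 determinant Hl.
rewrite Hr !det_mulmx !det_ublock !det_lblock !det1 !mul1r !mulr1.
by move=> ->.
Qed.

(** Families are maps, possibly not injective, rather than subsets: no order on [T] has to be
    chosen, at the price of a factor n! in Cauchy-Binet. *)
Definition rowfam (T : Type) n (g : T -> 'rV[K]_n) (f : 'I_n -> T) : 'M[K]_n :=
  \matrix_(i, j) g (f i) 0 j.

(* Cauchy-Binet, with every n-element subset of T counted n! times. *)
Lemma det_sum_gram (T : finType) n (P : {set T}) (g : T -> 'rV[K]_n) :
  \det (\sum_(s in P) (g s)^T *m g s) *+ n`!
    = \sum_(f : {ffun 'I_n -> T} | f \in ffun_on (mem P))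
        \det (rowfam g f) ^+ 2.
Proof.
pose a (f : 'I_n -> T) := \prod_i g (f i) 0 i.
(* Row i of the Gram matrix is the combination of the vectors [g t] with coefficients [g t 0 i];
   multilinearity picks one [t = f i] for each row. *)
have step : \det (\sum_(s in P) (g s)^T *m g s)
    = \sum_(f : {ffun 'I_n -> T} | f \in ffun_on (mem P)) a f * \det (rowfam g f).
  under [RHS]eq_bigr do rewrite /determinant big_distrr /=.
  rewrite exchange_big /=; apply: eq_bigr => s _.
  have -> : \prod_i (\sum_(t in P) (g t)^T *m g t) i (s i)
      = \prod_i \sum_(t in P) (g t 0 i * g t 0 (s i)).
    apply: eq_bigr => i _; rewrite summxE; apply: eq_bigr => t _.
    by rewrite mxE big_ord1 !mxE.
  rewrite bigA_distr_big /= big_distrr /=; apply: eq_bigr => f _.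
  rewrite big_split /= mulrCA; congr (_ * (_ * _)).
  by apply: eq_bigr => i _; rewrite mxE.
(* Replace f by f o s for every permutation s and add up. *)
have perm_step (s : 'S_n) : \det (\sum_(s in P) (g s)^T *m g s)
    = \sum_(f : {ffun 'I_n -> T} | f \in ffun_on (mem P))
        (-1) ^+ s * a (f \o s) * \det (rowfam g f).
  pose h (s : 'S_n) (f : {ffun 'I_n -> T}) := [ffun i => f (s i)].
  have hK t : cancel (h t^-1%g) (h t) by move=> f; apply/ffunP => i; rewrite !ffunE permK.
  rewrite step (reindex (h s)) /=; last first.
    by exists (h s^-1%g) => f _; [have := hK s^-1%g f; rewrite invgK | apply: hK].
  apply: eq_big => [f|f _].
    apply/ffun_onP/ffun_onP => H i; last by rewrite ffunE.
    by have := H (s^-1%g i); rewrite ffunE permKV.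
  have -> : rowfam g (h s f) = row_perm s (rowfam g f).
    by apply/matrixP => i j; rewrite !mxE ffunE.
  rewrite row_permE det_mulmx det_perm mulrCA mulrA; congr (_ * _ * _).
  by apply: eq_bigr => i _; rewrite ffunE.
(* Summed over all [s], the signed products [a (f \o s)] form the Leibniz expansion of the transpose
   of [rowfam g f], which supplies the second factor of the square. *)
rewrite -[n`!]card_Sn -sumr_const.
under eq_bigr => s _ do rewrite (perm_step s).
rewrite exchange_big /=; apply: eq_bigr => f _.
rewrite -big_distrl /= expr2; congr (_ * _).
rewrite -det_tr /determinant; apply: eq_bigr => s _.
by congr (_ * _); apply: eq_bigr => i _; rewrite !mxE.
Qed.
End Determinants.

(** * Coefficients of the characteristic polynomial: principal minors and eigenvalues *)

Section Coefficients.
Variable K : comNzRingType.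

Lemma prod_subset_const n (J : {set 'I_n}) (L : comNzRingType) (a b : L) :
  \prod_i (if i \in J then a else b) = a ^+ #|J| * b ^+ (n - #|J|).
Proof.
rewrite (bigID (mem J)) /= /=.
have -> : (n - #|J| = #|~: J|)%N by rewrite [RHS]cardsCs setCK card_ord.
congr (_ * _); last first.
  rewrite (eq_bigr (fun=> b)) => [|i /negbTE ->] //.
  rewrite prodr_const; congr (_ ^+ _); apply: eq_card => i.
  by rewrite !inE.
by rewrite (eq_bigr (fun=> a)) => [|i ->] //; rewrite prodr_const.
Qed.

(** Expanding by rows, pull -1 out of the rows in [J] and X out of the others: what is left is
    constant, so [J] contributes one monomial of degree [n - #|J|]. Rows of the identity outside [J]
    express the principal minor without passing to a submatrix. *)
Lemma coef_char_poly n (M : 'M[K]_n) k : (k <= n)%N ->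
  (char_poly M)`_(n - k) = (-1) ^+ k *
    \sum_(J : {set 'I_n} | #|J| == k)
      \det (\matrix_(i, j) if i \in J then M i j else (1%:M : 'M_n) i j).
Proof.
move=> kn; have -> : char_poly M = \det (- map_mx polyC M + 'X%:M) by rewrite addrC.
rewrite det_addmx coef_sum big_distrr /=.
rewrite [RHS]big_mkcond /=; apply: eq_bigr => J _.
set M' := (\matrix_(i, j) if i \in J then M i j else _).
have -> : (\matrix_(i, j) if i \in J then (- map_mx polyC M) i j else 'X%:M i j)
    = diag_mx (\row_i if i \in J then -1 else 'X) *m map_mx polyC M'.
  apply/matrixP => i j; rewrite mul_diag_mx !mxE.
  case: ifP => _; first by rewrite mulN1r.
  by rewrite rmorphMn /= polyC1 mulrnAr mulr1.
rewrite det_mulmx det_diag det_map_mx /=.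
under eq_bigr do rewrite mxE.
rewrite prod_subset_const -(rmorphN1 polyC) -rmorphXn /= -mulrA.
rewrite coefCM mulrC coefMC coefXn.
have Jn : (#|J| <= n)%N by have := max_card (mem J); rewrite card_ord.
rewrite (_ : (n - k == n - #|J|)%N = (#|J| == k)); last first.
  by apply/eqP/eqP; lia.
case: eqP => [->|_]; last by rewrite mul0r mul0r.
by rewrite mul1r mulrC.
Qed.

(** Vieta's formula; the expansion runs over sets of positions, so repeated roots keep their
    multiplicity. *)
Lemma coef_prod_XsubC (s : seq K) k : (k <= size s)%N ->
  (\prod_(z <- s) ('X - z%:P))`_(size s - k) = (-1) ^+ k * elem_sym k s.
Proof.
move=> ks; rewrite (big_nth 0) big_mkord.
under eq_bigr => i _ do rewrite addrC -polyCN.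
rewrite bigA_distr coef_sum /elem_sym big_distrr /= [RHS]big_mkcond /=.
apply: eq_bigr => J _.
have -> : \prod_i (if i \in J then (- s`_i)%:P else 'X)
    = (\prod_(i in J) - s`_i)%:P * 'X^(size s - #|J|).
  rewrite (bigID (mem J)) /=; congr (_ * _).
    by rewrite rmorph_prod; apply: eq_bigr => i ->.
  rewrite (eq_bigr (fun=> 'X)) => [|i /negbTE ->] //.
  rewrite prodr_const; congr (_ ^+ _).
  rewrite -[X in (X - _)%N](card_ord (size s)) -[in RHS](setCK J) -cardsCs.
  apply: eq_card => i.
  by rewrite !inE.
rewrite coefCM coefXn prodrN.
have Jn : (#|J| <= size s)%N by have := max_card (mem J); rewrite card_ord.
rewrite (_ : (size s - k == size s - #|J|)%N = (#|J| == k)); last first.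
  by apply/eqP/eqP; lia.
by case: eqP => [<-|_]; rewrite ?mulr1 ?mulr0.
Qed.
End Coefficients.

(** The characteristic polynomial is monic of degree [n], so it is the product over its [n] complex
    roots and Vieta's formula applies. *)
Lemma coef_char_poly_eigenvalues n (M : 'M[rat]_n) k : (k <= n)%N ->
  ratr (char_poly M)`_(n - k) = (-1) ^+ k * elem_sym k (eigenvalues M) :> algC.
Proof.
move=> kn; rewrite -coef_map /= /eigenvalues.
case: closed_field_poly_normal => s /= def_p.
have mon : lead_coef (map_poly (ratr : rat -> algC) (char_poly M)) = 1.
  by rewrite lead_coef_map (eqP (char_poly_monic M)) rmorph1.
have size_s : size s = n.
  have := size_map_poly (ratr : {rmorphism rat -> algC}) (char_poly M).
  by rewrite def_p mon scale1r size_prod_XsubC size_char_poly => -[].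
by rewrite def_p mon scale1r -{1}size_s coef_prod_XsubC ?size_s.
Qed.

(** * The index of a full-rank sublattice of Z^r *)

Lemma absz_unit (x : int) : x \is a GRing.unit -> `|x|%N = 1%N.
Proof.
move=> ux; have := congr1 absz (mulrV ux).
by rewrite abszM => /eqP; rewrite muln_eq1 => /andP[/eqP].
Qed.

Lemma card_fset_set_range (F : finType) (T : choiceType) (g : F -> T) :
  injective g -> #|` fset_set (range g)|%fset = #|F|.
Proof.
move=> g_inj; have fin : finite_set (range g) by apply/finite_image/finite_finset.
have -> : fset_set (range g) = [fset g x | x in F]%fset.
  apply/fsetP => t; rewrite in_fset_set //; apply/idP/idP.
    by rewrite in_setE => -[x _ <-]; apply/imfsetP; exists x.
  by case/imfsetP => x _ ->; rewrite in_setE; exists x.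
by rewrite card_imfset //= cardT enumT.
Qed.

(** [cl] is any labelling of the cosets of the lattice of multiples of the [D i]; vectors of
    remainders represent each coset once. *)
Lemma card_box_quotient r (D : 'I_r -> int) (T : choiceType)
    (cl : 'rV[int]_r -> T) :
    (forall i, D i != 0) ->
    (forall u v, cl u = cl v <-> forall i, (D i %| (u 0 i - v 0 i)%R)%Z) ->
  #|` fset_set (range cl)|%fset = (\prod_i `|D i|)%N.
Proof.
move=> D0 clE.
pose F := {dffun forall i : 'I_r, 'I_(absz (D i))}.
pose g (f : F) := cl (\row_i (f i)%:Z).
have modb (u : 'rV[int]_r) i : (absz ((u 0 i)%R %% D i)%Z < absz (D i))%N.
  by have := ltz_mod (u 0 i) (D0 i); have := modz_ge0 (u 0 i) (D0 i); lia.
have -> : range cl = range g.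
  apply/seteqP; split => _ [u _ <-]; last by exists (\row_i (u i)%:Z).
  exists [ffun i => Ordinal (modb u i)] => //; apply/clE => i.
  rewrite !mxE ffunE /= -eqz_mod_dvd gez0_abs ?modz_ge0 //.
  by rewrite modz_mod.
rewrite card_fset_set_range.
  rewrite card_dep_ffun foldrE big_map big_enum /=.
  by apply: eq_bigr => i _; rewrite card_ord.
move=> f f' /clE H; apply/ffunP => i; apply: val_inj => /=.
have := H i; rewrite !mxE dvdzE.
move: (ltn_ord (f i)) (ltn_ord (f' i)).
move: (nat_of_ord (f i)) (nat_of_ord (f' i)) => a b aD bD.
case: (posnP `|a%:Z - b%:Z|%N) => [|ab_gt0]; first by lia.
by rewrite gtnNdvd //; lia.
Qed.

(** In the Smith form [L *m D *m Q] the unimodular factors do not change the absolute determinant,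
    and the change of coordinates by [Q] turns the row lattice of [C] into the box lattice of
    [D]. *)
Lemma card_lattice_quotient r (C : 'M[int]_r) (T : choiceType)
    (cl : 'rV[int]_r -> T) :
    \det C != 0 ->
    (forall u v, cl u = cl v <-> exists w, u - v = w *m C) ->
  #|` fset_set (range cl)|%fset = `|\det C|%N.
Proof.
have [L uL [Q uQ [D _ ->]]] := int_Smith_normal_form C.
set d := \matrix_(i, j) _.
have -> : d = diag_mx (\row_i D`_i).
  by apply/matrixP => i j; rewrite !mxE.
have dL : `|\det L|%N = 1%N by apply: absz_unit; rewrite -unitmxE.
have dQ : `|\det Q|%N = 1%N by apply: absz_unit; rewrite -unitmxE.
rewrite !det_mulmx det_diag !abszM dL dQ muln1 mul1n.
rewrite !mulf_eq0 !negb_or -andbA => /and3P[_ prod0 _] clE.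
have D0 (i : 'I_r) : D`_i != 0.
  by move/prodf_neq0: prod0 => /(_ i isT); rewrite mxE.
have rangeE : range cl = range (fun u => cl (u *m Q)).
  apply/seteqP; split => _ [u _ <-]; last by exists (u *m Q).
  by exists (u *m invmx Q); rewrite ?mulmxKV.
rewrite rangeE (@card_box_quotient _ (fun i : 'I_r => D`_i)) => // [|u v].
  rewrite (big_morph absz abszM (erefl : `|1%:Z|%N = 1%N)).
  by apply: eq_bigr => i _; rewrite mxE.
rewrite clE; split => [[w]|dvd].
  rewrite -mulmxBl mulmxA => /(can_inj (mulmxK uQ)) uv i.
  move/matrixP/(_ 0 i): uv; rewrite mulmxA mul_mx_diag !mxE => ->.
  exact: dvdz_mull.
exists ((\row_i ((u 0 i - v 0 i)%R %/ D`_i)%Z) *m invmx L).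
rewrite !mulmxA mulmxKV // -mulmxBl; congr (_ *m _).
apply/rowP => i; rewrite mul_mx_diag !mxE divzK //.
Qed.

(** * Torsion of integral homology as a lattice index *)

Section CellularMatrices.
Variables (R : realType) (X : finite_CW R).

Definition chain_of_row (u : 'rV[int]_#|cell X|) : chain X int :=
  [ffun s => u 0 (enum_rank s)].

Definition row_of_chain (c : chain X int) : 'rV[int]_#|cell X| :=
  \row_j c (enum_val j).

Lemma chain_of_rowK : cancel chain_of_row row_of_chain.
Proof. by move=> u; apply/rowP => j; rewrite !mxE ffunE enum_valK. Qed.

Lemma row_of_chainK : cancel row_of_chain chain_of_row.
Proof. by move=> c; apply/ffunP => s; rewrite !ffunE mxE enum_rankK. Qed.

Lemma chain_of_rowB u v :
  chain_of_row (u - v) = chain_of_row u - chain_of_row v.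
Proof. by apply/ffunP => s; rewrite !ffunE !mxE. Qed.

Lemma chain_of_rowD u v :
  chain_of_row (u + v) = chain_of_row u + chain_of_row v.
Proof. by apply/ffunP => s; rewrite !ffunE !mxE. Qed.

Lemma chain_of_rowMn u m : chain_of_row (u *+ m) = chain_of_row u *+ m.
Proof. by apply/ffunP => s; rewrite ffunMnE !ffunE mulmxnE. Qed.

Definition incidence_mx r (f : 'I_r -> cell X) : 'M[int]_(r, #|cell X|) :=
  \matrix_(i, j) incidence (f i) (enum_val j).

Lemma cells_subcomplex i (V : {set cell X}) :
  V \subset cells X i.+1 -> subcomplex i.+1 V :&: cells X i.+1 = V.
Proof.
move=> /subsetP Vd; apply/setP => s; rewrite !inE /=.
apply/andP/idP => [[/orP[|] // dims /eqP dimE]|sV].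
  by rewrite dimE ltnn in dims.
by split; [rewrite sV orbT | have := Vd s sV; rewrite inE].
Qed.

Lemma boundary_boundary (c : chain X int) : boundary (boundary c) = 0.
Proof.
apply/ffunP => u; rewrite !ffunE.
under eq_bigr do rewrite ffunE big_distrl /=.
rewrite exchange_big /= big1 // => s _.
under eq_bigr do rewrite -mulrA !intz.
by rewrite -big_distrr /= incidence_incidence mulr0.
Qed.

Section Forest.
Variables (i r : nat) (f : 'I_r -> cell X) (V : {set cell X}).
Hypotheses (f_inj : injective f) (V_def : V = f @: [set: 'I_r]%SET).
Hypothesis dim_f : forall a, Defs.dim (f a) = i.+1.

Let Vd : V \subset cells X i.+1.
Proof. by apply/subsetP => s; rewrite V_def => /imsetP[a _ ->]; rewrite inE dim_f. Qed.

Lemma int_boundariesE (x : chain X int) :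
  int_boundaries i (subcomplex i.+1 V) x
    <-> exists w, x = chain_of_row (w *m incidence_mx f).
Proof.
split=> [[y ychain <-]|[w ->]].
  exists (\row_a y (f a)); apply/ffunP => t; rewrite !ffunE !mxE.
  rewrite (bigID (mem V)) /= [X in _ + X]big1 ?addr0 => [|s sV]; last first.
    by rewrite ychain ?mul0r // cells_subcomplex.
  rewrite V_def big_imset /=; last by move=> a b _ _; apply: f_inj.
  apply: eq_big => [a|a _]; first by rewrite inE.
  by rewrite !mxE enum_rankK intz.
pose y : chain X int := [ffun s => \sum_a (w 0 a *+ (f a == s))].
have yf a : y (f a) = w 0 a.
  rewrite ffunE (bigD1 a) //= eqxx big1 ?addr0 // => b ba.
  by rewrite (inj_eq f_inj) (negbTE ba).
have yV s : s \notin V -> y s = 0.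
  move=> sV; rewrite ffunE big1 // => a _.
  by case: eqP => // fas; rewrite -fas V_def imset_f ?inE in sV.
exists y; first by move=> s; rewrite cells_subcomplex //; apply: yV.
apply/ffunP => t; rewrite !ffunE !mxE.
rewrite (bigID (mem V)) /= [X in _ + X]big1 ?addr0 => [|s sV]; last first.
  by rewrite yV ?mul0r.
rewrite V_def big_imset /=; last by move=> a b _ _; apply: f_inj.
apply: eq_big => [a|a _]; first by rewrite inE.
by rewrite yf !mxE enum_rankK intz.
Qed.

(** The right inverse [Q] makes the row lattice of [P] saturated, and the boundaries have finite
    index in it since [\det C != 0]. So the chains with a positive multiple that bounds are exactly
    this lattice, and the torsion subgroup is Z^r modulo the rows of [C]. *)
Lemma torsion_order_det (C : 'M[int]_r) (P : 'M_(r, #|cell X|)) Q :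
    incidence_mx f = C *m P -> P *m Q = 1%:M -> \det C != 0 ->
  torsion_order i (subcomplex i.+1 V) = `|\det C|%N.
Proof.
move=> NE PQ detC.
set Y := subcomplex i.+1 V.
(* The support and the vanishing of the boundary can both be tested on a positive multiple, as
   integers have no torsion. *)
have bound_cycle (c : chain X int) m :
    (0 < m)%N -> int_boundaries i Y (c *+ m) -> int_cycles i Y c.
  move=> m0 bc; split.
    move=> s sY; have /int_boundariesE[w cw] := bc.
    have : (c *+ m) s = 0.
      rewrite cw ffunE mxE big1 // => a _; rewrite mxE enum_rankK.
      rewrite incidence_dim ?mulr0 //; apply: contraNneq sY => dimE.
      by rewrite !inE -(eqP (_ : Defs.dim s == i)) ?leqnn //= -eqSS -dimE dim_f.
    by rewrite ffunMnE => /eqP; rewrite mulrn_eq0 gtn_eqF //= => /eqP.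
  have [y _ yE] := bc.
  have : boundary (c *+ m) = 0 by rewrite -yE boundary_boundary.
  rewrite linearMn /= => bm; apply/ffunP => t; rewrite [RHS]ffunE.
  have : (boundary c *+ m) t = 0 by rewrite bm ffunE.
  by rewrite ffunMnE => /eqP; rewrite mulrn_eq0 gtn_eqF //= => /eqP.
have bound_lattice u : int_boundaries i Y (chain_of_row (u *m P))
    <-> exists w, u = w *m C.
  rewrite int_boundariesE; split=> -[w].
    move/(can_inj chain_of_rowK); rewrite NE => /(congr1 (mulmx^~ Q)).
    by rewrite -!mulmxA PQ !mulmx1 => ->; exists w.
  by move=> ->; exists w; rewrite NE mulmxA.
pose cl u := homology_class i Y (chain_of_row (u *m P)).
have P_torsion u : exists2 m, (0 < m)%N
    & int_boundaries i Y (chain_of_row (u *m P) *+ m).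
  exists `|\det C|%N; first by rewrite absz_gt0.
  rewrite -chain_of_rowMn -scaler_nat scalemxAl; apply/bound_lattice.
  (* The adjugate produces [\det C] times [u]; the sign makes the multiple positive. *)
  exists (Num.sg (\det C) *: u *m \adj C).
  by rewrite -mulmxA mul_adj_mx mul_mx_scalar scalerA mulrC natz abszE normrEsg.
have P_cycle u : int_cycles i Y (chain_of_row (u *m P)).
  by have [m m0 bm] := P_torsion u; apply: bound_cycle bm.
have cl_torsion : torsion_homology i Y = range cl.
  apply/seteqP; split => [_ [c [cc [m m0 /int_boundariesE[w cw]]] <-]|_ [u _ <-]].
    (* A multiple of [c] lies in the row lattice of [P], where right multiplication by [Q *m P] is
       the identity; dividing by [m] gives the same for [c]. *)
    exists (row_of_chain c *m Q) => //.
    congr (homology_class _ _ _); rewrite -[RHS]row_of_chainK; congr chain_of_row.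
    have cm : row_of_chain c *+ m = w *m C *m P.
      rewrite -mulmxA -NE -[RHS]chain_of_rowK -cw; apply/rowP => j.
      by rewrite !(mxE, mulmxnE) ffunMnE.
    have : (row_of_chain c *m Q *m P - row_of_chain c) *+ m = 0.
      rewrite mulrnBl cm -!scaler_nat !scalemxAl scaler_nat cm.
      by rewrite -[w *m C *m P *m Q]mulmxA PQ mulmx1 subrr.
    move/matrixP => z; apply/matrixP => a j; move: (z a j).
    rewrite mulmxnE !mxE => /eqP; rewrite mulrn_eq0 gtn_eqF //= subr_eq0.
    by move/eqP.
  by exists (chain_of_row (u *m P)).
rewrite /torsion_order cl_torsion; apply: card_lattice_quotient => // u v.
rewrite -bound_lattice mulmxBl chain_of_rowB /cl; split=> [uv|uv].
  have : homology_class i Y (chain_of_row (u *m P)) (chain_of_row (u *m P)).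
    split=> //; rewrite subrr; apply/int_boundariesE; exists 0.
    by rewrite mul0mx; apply/ffunP => s; rewrite !ffunE mxE.
  by rewrite uv => -[].
apply/seteqP; split => c [cc bc]; split=> //.
  have [w1 e1] := (int_boundariesE _).1 uv; have [w2 e2] := (int_boundariesE _).1 bc.
  apply/int_boundariesE; exists (w1 + w2).
  by rewrite mulmxDl chain_of_rowD -e1 -e2 [RHS]addrC addrA subrK.
have [w1 e1] := (int_boundariesE _).1 uv; have [w2 e2] := (int_boundariesE _).1 bc.
apply/int_boundariesE; exists (w2 - w1).
by rewrite mulmxBl chain_of_rowB -e1 -e2 opprB addrA subrK.
Qed.

End Forest.
End CellularMatrices.

(* Smith normal form splits N as C P with P a basis of the saturation
   of the row lattice of N. *)
Lemma row_free_saturation r c (N : 'M[int]_(r, c)) :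
    row_free (map_mx intr N : 'M[rat]_(r, c)) ->
  exists C : 'M_r, exists P : 'M_(r, c), exists Q : 'M_(c, r),
    [/\ N = C *m P, P *m Q = 1%:M & \det C != 0].
Proof.
move=> freeN; have rc : (r <= c)%N by rewrite -(eqP freeN) rank_leq_col.
have [L uL [S uS [D _ NE]]] := int_Smith_normal_form N.
(* [P] consists of the first [r] rows of the unimodular [S], and [Q] of the first [r] columns of its
   inverse. *)
exists (L *m diag_mx (\row_i D`_i)), (pid_mx r *m S), (invmx S *m pid_mx r).
have NE' : N = L *m diag_mx (\row_i D`_i) *m (pid_mx r *m S).
  rewrite NE !mulmxA; congr (_ *m _); rewrite -mulmxA; congr (_ *m _).
  apply/matrixP => i j; rewrite mul_diag_mx !mxE ltn_ord andbT.
  by rewrite mulr_natr.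
split=> //.
  by rewrite mulmxA mulmxK // mul_pid_mx minnn (minn_idPr rc) pid_mx_1.
set C := L *m _ in NE' *.
(* [N] has rank [r] and factors through [C], so [C] has full rank. *)
have : row_free (map_mx intr C : 'M[rat]_r).
  rewrite -row_leq_rank -[X in (X <= _)%N](eqP freeN) NE' map_mxM.
  exact: mxrankM_maxl.
by rewrite row_free_unit unitmxE det_map_mx unitfE intr_eq0.
Qed.

Lemma row_free_mul_eq0 (K : fieldType) m n (A : 'M[K]_(m, n)) (w : 'rV_m) :
  row_free A -> w *m A = 0 -> w = 0.
Proof. by move=> freeA wA; apply: (row_free_inj freeA); rewrite wA mul0mx. Qed.

(** * Chains, cycles and boundaries over a field, in coordinates *)

Section ChainSpaces.
Variables (R : realType) (X : finite_CW R) (K : fieldType).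

Lemma mem_chains i (Y : {set cell X}) (c : chain X K) :
  reflect (forall s, s \notin (Y :&: cells X i)%SET -> c s = 0) (c \in chains K i Y).
Proof.
apply: (iffP idP) => [|c0].
  move/coord_span => -> s sY.
  rewrite sum_ffunE big1 // => a _.
  have /mapP[t] : [seq cell_chain K s | s in (Y :&: cells X i)%SET]`_a
      \in [seq cell_chain K s | s in (Y :&: cells X i)%SET].
    by rewrite mem_nth ?size_image.
  rewrite mem_enum /= => tY ->; rewrite !ffunE.
  by case: eqP => [st|_]; [rewrite st tY in sY | rewrite scaler0].
have -> : c = \sum_(s in Y :&: cells X i) c s *: cell_chain K s.
  apply/ffunP => t; rewrite sum_ffunE.
  have [tY|tY] := boolP (t \in Y :&: cells X i).
    rewrite (bigD1 t) //= !ffunE eqxx big1 ?addr0 => [|s /andP[_ st]].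
      by rewrite /GRing.scale /= mulr1.
    by rewrite !ffunE eq_sym (negbTE st) scaler0.
  rewrite c0 // big1 // => s sY; rewrite !ffunE.
  by case: eqP => [ts|_]; [rewrite ts sY in tY | rewrite scaler0].
by apply: memv_suml => s sY; apply/memvZ/memv_span/map_f; rewrite mem_enum.
Qed.

Lemma mem_cycles i (Y : {set cell X}) (c : chain X K) :
  reflect ((forall s, s \notin (Y :&: cells X i)%SET -> c s = 0) /\ boundary c = 0)
          (c \in cycles K i Y).
Proof.
rewrite memv_cap memv_ker lfunE /=.
by apply: (iffP andP) => -[/mem_chains ? /eqP ?]; split=> //; apply/mem_chains.
Qed.

Lemma boundary_cell_chain (s t : cell X) :
  boundary (cell_chain K s) t = (incidence s t)%:~R.
Proof.
rewrite ffunE (bigD1 s) //= ffunE eqxx mul1r big1 ?addr0 // => u us.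
by rewrite ffunE (negbTE us) mul0r.
Qed.

Lemma dim_chains i (Y : {set cell X}) :
  \dim (chains K i Y) = #|(Y :&: cells X i)%SET|.
Proof.
rewrite [LHS](eqP (_ : free _)) ?size_image //.
apply/freeP => k k0 a.
move/ffunP/(_ (enum_val a)): k0; rewrite sum_ffunE [RHS]ffunE.
rewrite (bigD1 a) //= nth_image !ffunE eqxx big1 => [|b ba].
  by rewrite addr0 /GRing.scale /= mulr1.
rewrite nth_image !ffunE (inj_eq enum_val_inj) eq_sym (negbTE ba).
by rewrite scaler0.
Qed.

Definition boundary_row (s : cell X) : 'rV[K]_#|cell X| :=
  \row_j (incidence s (enum_val j))%:~R.

Lemma boundary_row_sum (c : chain X K) t :
  boundary c t = (\sum_s c s *: boundary_row s) 0 (enum_rank t).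
Proof.
rewrite summxE ffunE; apply: eq_bigr => s _.
by rewrite !mxE enum_rankK.
Qed.

Definition boundary_mx r (f : 'I_r -> cell X) : 'M[K]_(r, #|cell X|) :=
  map_mx intr (incidence_mx f).

Lemma mul_boundary_mx r (f : 'I_r -> cell X) (w : 'rV[K]_r) :
  w *m boundary_mx f = \sum_a w 0 a *: boundary_row (f a).
Proof.
apply/rowP => j; rewrite mxE summxE; apply: eq_bigr => a _.
by rewrite !mxE.
Qed.

Section Family.
Variables (i r : nat) (f : 'I_r -> cell X) (V : {set cell X}).
Hypotheses (f_inj : injective f) (V_def : V = f @: [set: 'I_r]%SET).
Hypothesis dim_f : forall a, Defs.dim (f a) = i.+1.

(** The i-skeleton has no (i+1)-cells, so a cycle is a linear relation between the rows of
    [boundary_mx f], given by its coefficients on [V]. *)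
Lemma cycles_eq0 (Y : {set cell X}) :
  (cycles K i.+1 (skeleton i Y :|: V) == 0%VS) = row_free (boundary_mx f).
Proof.
have dcells s : (s \in (skeleton i Y :|: V) :&: cells X i.+1) = (s \in V).
  rewrite !inE; apply/andP/idP => [[/orP[/andP[_]|//]]|sV].
    by move=> dims /eqP dimE; rewrite dimE ltnn in dims.
  rewrite sV orbT; split=> //.
  by move: sV; rewrite V_def => /imsetP[a _ ->]; rewrite dim_f.
apply/idP/idP => [/eqP Z0|free].
  rewrite -kermx_eq0; apply/rowV0P => w /sub_kermxP.
  rewrite mul_boundary_mx => w0.
  pose c : chain X K := [ffun s => \sum_a w 0 a *+ (f a == s)].
  have cf a : c (f a) = w 0 a.
    rewrite ffunE (bigD1 a) //= eqxx big1 ?addr0 // => b ba.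
    by rewrite (inj_eq f_inj) (negbTE ba).
  have cV s : s \notin V -> c s = 0.
    move=> sV; rewrite ffunE big1 // => a _.
    by case: eqP => // fas; rewrite -fas V_def imset_f ?inE in sV.
  have : c \in cycles K i.+1 (skeleton i Y :|: V).
    apply/mem_cycles; split=> [s|]; first by rewrite dcells; apply: cV.
    apply/ffunP => t; rewrite boundary_row_sum [RHS]ffunE.
    rewrite (bigID (mem V)) /= [X in _ + X]big1 ?addr0 => [|s sV]; last first.
      by rewrite cV ?scale0r.
    rewrite V_def big_imset /=; last by move=> a b _ _; apply: f_inj.
    rewrite (eq_bigl xpredT) => [|a]; last by rewrite inE.
    by under eq_bigr do rewrite cf; rewrite w0 mxE.
  rewrite Z0 memv0 => /eqP c0; apply/rowP => a.
  by rewrite -cf c0 ffunE mxE.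
rewrite -subv0; apply/subvP => c /mem_cycles[cV c0]; rewrite memv0.
have w0 : (\row_a c (f a)) *m boundary_mx f = 0.
  rewrite mul_boundary_mx (eq_bigr (fun a => c (f a) *: boundary_row (f a))) => [|a _].
    2: by rewrite mxE.
  apply/rowP => j; rewrite [RHS]mxE.
  move/ffunP/(_ (enum_val j)): c0; rewrite boundary_row_sum [X in _ = X]ffunE enum_valK.
  rewrite (bigID (mem V)) /= [X in _ + X]big1 ?addr0 => [|s sV]; last first.
    by rewrite cV ?scale0r // dcells.
  rewrite V_def big_imset /=; last by move=> a b _ _; apply: f_inj.
  rewrite (eq_bigl xpredT) => [|a]; last by rewrite inE.
  by move=> ->.
apply/eqP/ffunP => s; rewrite [RHS]ffunE.
have [|sV] := boolP (s \in V); last by rewrite cV ?dcells.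
rewrite V_def => /imsetP[a _ ->].
have /rowP/(_ a) := row_free_mul_eq0 free w0.
by rewrite !mxE.
Qed.

Let spans := [tuple boundary (cell_chain K (f a)) | a < r].

Let span_sub (Y : {set cell X}) :
  (forall a, f a \in Y) -> (<<spans>> <= boundaries K i Y)%VS.
Proof.
move=> fY; apply/span_subvP => v /mapP[a _ ->].
rewrite -[boundary _](lfunE (@boundary R X K)); apply: memv_img.
apply/mem_chains => s sY; rewrite ffunE.
by case: eqP => // sE; rewrite sE inE fY inE dim_f eqxx in sY.
Qed.

Let spans_free : row_free (boundary_mx f) -> free spans.
Proof.
move=> free_f; apply/freeP => k k0 a.
have : (\row_a k a) *m boundary_mx f = 0.
  rewrite mul_boundary_mx; apply/rowP => j; rewrite [RHS]mxE.
  move/ffunP/(_ (enum_val j)): k0; rewrite sum_ffunE [X in _ = X -> _]ffunE => <-.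
  rewrite summxE; apply: eq_bigr => a' _.
  by rewrite -tnth_nth tnth_mktuple !mxE [RHS]ffunE boundary_cell_chain.
move=> w0; have /rowP/(_ a) := row_free_mul_eq0 free_f w0.
by rewrite !mxE.
Qed.

Lemma dim_boundaries_ge (Y : {set cell X}) :
  (forall a, f a \in Y) -> row_free (boundary_mx f) ->
  (r <= \dim (boundaries K i Y))%N.
Proof.
move=> fY /spans_free /eqP; rewrite size_tuple => <-.
exact/dimvS/span_sub.
Qed.

(** The boundaries of the [f a] are [r] independent vectors in a space of dimension [r], hence a
    basis of it. *)
Lemma boundary_row_sub (Y : {set cell X}) (s : cell X) :
    (forall a, f a \in Y) -> row_free (boundary_mx f) ->
    \dim (boundaries K i Y) = r -> s \in Y -> Defs.dim s = i.+1 ->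
  (boundary_row s <= boundary_mx f)%MS.
Proof.
move=> fY free_f dimY sY dims.
have /eqP spanE : <<spans>>%VS == boundaries K i Y.
  by rewrite eqEdim span_sub // dimY (eqP (spans_free free_f)) size_tuple /=.
have : boundary (cell_chain K s) \in <<spans>>%VS.
  rewrite spanE -[boundary _](lfunE (@boundary R X K)); apply: memv_img.
  apply/mem_chains => t tY; rewrite ffunE.
  by case: eqP => // tE; rewrite tE inE sY inE dims eqxx in tY.
move/coord_span => sE; apply/submxP.
exists (\row_a coord spans a (boundary (cell_chain K s))).
rewrite mul_boundary_mx; apply/rowP => j; rewrite summxE mxE.
rewrite -boundary_cell_chain {1}sE sum_ffunE; apply: eq_bigr => a _.
by rewrite -tnth_nth tnth_mktuple !mxE ffunE boundary_cell_chain.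
Qed.

End Family.
End ChainSpaces.

(** * Coordinates with respect to the forest, and the mesh matrix *)

Section ForestExpansion.
Variables (R : realType) (X : finite_CW R) (i : nat) (V0 : {set cell X}).
Hypothesis forestV0 : spanning_forest i.+1 [set: cell X] V0.

Let r := #|V0|.
Let e (a : 'I_r) : cell X := enum_val a.

(** Forests are defined by real cycles but the mesh matrix is rational; the rank of an integral
    matrix is the same over both fields. *)
Lemma row_free_boundary_real n (f : 'I_n -> cell X) :
  row_free (boundary_mx R f) = row_free (boundary_mx rat f).
Proof.
rewrite -(row_free_map (ratr : {rmorphism rat -> R})) -map_mx_comp.
by congr row_free; apply/matrixP => a j; rewrite !mxE /= ratr_int.
Qed.

Let V0d : V0 \subset cells X i.+1.
Proof. by case/and3P: forestV0; rewrite setTI. Qed.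

Let e_inj : injective e. Proof. exact: enum_val_inj. Qed.

Let imset_e : V0 = e @: [set: 'I_r]%SET.
Proof.
apply/setP => s; apply/idP/imsetP => [sV|[a _ ->]]; last exact: enum_valP.
by exists (enum_rank_in sV s); rewrite ?inE // /e enum_rankK_in.
Qed.

Let dim_e a : Defs.dim (e a) = i.+1.
Proof. by have /(subsetP V0d) := enum_valP a; rewrite inE => /eqP. Qed.

Let e_free : row_free (boundary_mx rat e).
Proof.
case/and3P: forestV0 => _ _; rewrite (cycles_eq0 _ e_inj imset_e dim_e).
by rewrite row_free_boundary_real.
Qed.

Let dim_boundaries : \dim (boundaries rat i [set: cell X]) = r.
Proof. by case/and3P: forestV0 => _ /eqP cV _; rewrite /r cV. Qed.

(** Rank-nullity for the boundary map on (i+1)-chains, whose rank is [#|V0|]. *)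
Lemma card_cotree_cells : #|cells X i.+1 :\: V0| = cycle_dim X i.+1.
Proof.
have := limg_ker_dim (linfun (@boundary R X rat)) (chains rat i.+1 [set: cell X]).
rewrite -/(boundaries _ _ _) -/(cycles _ _ _) -/(cycle_dim _ _) dim_boundaries.
rewrite dim_chains setTI cardsD (setIidPr V0d) => <-.
by rewrite addnK.
Qed.

(** For an (i+1)-cell [s], the coordinates of its boundary in the basis formed by the boundaries of
    the cells of [V0]; [pinvmx] solves the linear system. *)
Definition forest_coord (s : cell X) : 'rV[rat]_r :=
  boundary_row rat s *m pinvmx (boundary_mx rat e).
Local Notation g := forest_coord.

Lemma forest_coordK s :
  Defs.dim s = i.+1 -> g s *m boundary_mx rat e = boundary_row rat s.
Proof.
move=> dims; apply: mulmxKpV.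
by apply: (boundary_row_sub dim_e _ e_free dim_boundaries).
Qed.

Lemma forest_coord_forest a : g (e a) = delta_mx 0 a.
Proof.
apply: (row_free_inj e_free); rewrite forest_coordK // -rowE.
by apply/rowP => j; rewrite !mxE.
Qed.

(** The right-hand side is a cycle with coefficient 1 on [s]. Any other such cycle differs from it
    by a cycle supported on [V0], which is zero because [V0] is a forest. *)
Lemma geometric_cycleE s : s \in cells X i.+1 :\: V0 ->
  geometric_cycle i.+1 V0 s
    = cell_chain rat s - \sum_a g s 0 a *: cell_chain rat (e a).
Proof.
rewrite inE => /andP[sV0 sd]; have /eqP dims : Defs.dim s == i.+1 by rewrite inE in sd.
set z := RHS.
have dV : V0 :|: [set s]%SET \subset cells X i.+1 by rewrite subUset V0d sub1set.
have es a : (s == e a) = false.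
  by apply: contraNF sV0 => /eqP ->; apply: enum_valP.
have zcyc : z \in cycles rat i.+1 (subcomplex i.+1 (V0 :|: [set s]%SET)).
  apply/mem_cycles; rewrite cells_subcomplex //; split=> [t|].
    rewrite !inE negb_or => /andP[tV0 ts]; rewrite !ffunE sum_ffunE (negbTE ts).
    rewrite big1 ?subr0 // => a _; rewrite !ffunE.
    by case: eqP => [te|_]; [rewrite te enum_valP in tV0 | rewrite scaler0].
  apply/ffunP => t; rewrite linearB linear_sum [RHS]ffunE [LHS]ffunE [in X in _ + X]ffunE.
  rewrite boundary_cell_chain sum_ffunE.
  have /rowP/(_ (enum_rank t)) := forest_coordK dims.
  rewrite mul_boundary_mx summxE [RHS]mxE enum_rankK => <-.
  apply/eqP; rewrite subr_eq0; apply/eqP; apply: eq_bigr => a _.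
  by rewrite linearZ /= ffunE boundary_cell_chain !mxE enum_rankK.
have zs : z s = 1.
  rewrite !ffunE sum_ffunE eqxx big1 ?subr0 // => a _.
  by rewrite !ffunE es scaler0.
clearbody z; apply: xget_unique => // y [/mem_cycles[yV y0] ys].
rewrite cells_subcomplex // in yV.
have : y - z \in cycles rat i.+1 (skeleton i [set: cell X] :|: V0).
  have /mem_cycles[zV z0] := zcyc; rewrite cells_subcomplex // in zV.
  apply/mem_cycles; split=> [t|]; last by rewrite linearB /= y0 z0 subrr.
  rewrite [_ :|: _]/(subcomplex i.+1 V0) cells_subcomplex // !ffunE => tV0.
  have [->|ts] := eqVneq t s; first by rewrite ys zs subrr.
  have tV : t \notin V0 :|: [set s]%SET by rewrite !inE negb_or tV0.
  by rewrite yV // zV // subrr.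
have /eqP -> : cycles rat i.+1 (skeleton i [set: cell X] :|: V0) == 0%VS.
  by rewrite (cycles_eq0 _ e_inj imset_e dim_e).
by rewrite memv0 subr_eq0 => /eqP.
Qed.

(** Outside [V0] the cycle of [s] is [s] alone, which gives the Kronecker symbol; on [V0] its
    coefficients are those of [- g s]. *)
Lemma mesh_entry s s' : s \in cells X i.+1 :\: V0 -> s' \in cells X i.+1 :\: V0 ->
  pairing (geometric_cycle i.+1 V0 s) (geometric_cycle i.+1 V0 s')
    = (s == s')%:R + \sum_a g s 0 a * g s' 0 a.
Proof.
move=> sB sB'; rewrite !geometric_cycleE // /pairing.
have off t a : t \in cells X i.+1 :\: V0 -> (e a == t) = false.
  rewrite inE => /andP[tV0 _]; apply: contraNF tV0 => /eqP <-.
  exact: enum_valP.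
have zE t u : (cell_chain rat t - \sum_a g t 0 a *: cell_chain rat (e a)) u
    = (u == t)%:R - \sum_a g t 0 a * (u == e a)%:R.
  rewrite !ffunE sum_ffunE; congr (_ - _); apply: eq_bigr => a _.
  by rewrite !ffunE.
have zV0 t a : t \in cells X i.+1 :\: V0 ->
    (cell_chain rat t - \sum_a g t 0 a *: cell_chain rat (e a)) (e a) = - g t 0 a.
  move=> tB; rewrite zE off // add0r (bigD1 a) //= eqxx mulr1 big1 ?addr0 // => b ba.
  by rewrite (inj_eq e_inj) eq_sym (negbTE ba) mulr0.
have znV0 t u : u \notin V0 ->
    (cell_chain rat t - \sum_a g t 0 a *: cell_chain rat (e a)) u = (u == t)%:R.
  move=> uV0; rewrite zE big1 ?subr0 // => a _.
  by case: eqP => [ue|_]; [rewrite ue enum_valP in uV0 | rewrite mulr0].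
rewrite (bigID (mem V0)) /= addrC; congr (_ + _).
  have sV0 : s \notin V0 by move: sB; rewrite inE => /andP[].
  rewrite (bigD1 s) //= !znV0 // eqxx mul1r big1 ?addr0 // => u /andP[uV0 us].
  by rewrite !znV0 // (negbTE us) mul0r.
rewrite [in LHS]imset_e big_imset /=; last by move=> a b _ _; apply: e_inj.
rewrite (eq_bigl xpredT) => [|a]; last by rewrite inE.
by apply: eq_bigr => a _; rewrite !zV0 // mulrNN.
Qed.

(** * Families of [r] cells: independence and torsion orders *)

Section Subfamily.
Variable f : 'I_r -> cell X.
Hypotheses (f_inj : injective f) (dim_f : forall a, Defs.dim (f a) = i.+1).
Let V := f @: [set: 'I_r]%SET.

Let boundary_mxE : boundary_mx rat f = rowfam g f *m boundary_mx rat e.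
Proof.
apply/row_matrixP => a; rewrite row_mul.
have -> : row a (rowfam g f) = g (f a) by apply/rowP => j; rewrite !mxE.
by rewrite forest_coordK //; apply/rowP => j; rewrite !mxE.
Qed.

(** Multiplication by the row-free [boundary_mx rat e] preserves rank, so independence of the
    boundaries amounts to invertibility of [rowfam g f]. *)
Lemma cycles_eq0_det (Y : {set cell X}) :
  (cycles R i.+1 (skeleton i Y :|: V) == 0%VS) = (\det (rowfam g f) != 0).
Proof.
rewrite (cycles_eq0 _ f_inj (erefl V) dim_f) row_free_boundary_real.
rewrite -unitfE -unitmxE -row_free_unit boundary_mxE.
by rewrite /row_free mxrankMfree.
Qed.

(* Both boundary matrices factor through one basis of the saturated lattice of
   boundaries, so that rowfam g f is the ratio of two integral matrices whose
   determinants are the torsion orders. *)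
Lemma det_torsion_ratio : \det (rowfam g f) != 0 ->
  \det (rowfam g f) ^+ 2 =
    ((torsion_order i (subcomplex i.+1 V))%:R
      / (torsion_order i (subcomplex i.+1 V0))%:R) ^+ 2.
Proof.
move=> detG; have [C [P [Q [eE PQ detC]]]] := row_free_saturation e_free.
have eE' : boundary_mx rat e = map_mx intr C *m map_mx intr P.
  by rewrite -map_mxM -eE.
(* Coordinates of the boundaries in the basis [P], read off by [Q]: integral by construction, and
   equal over the rationals to [rowfam g f] times [C]. *)
pose Cf := incidence_mx f *m Q.
have CfE : map_mx intr Cf = rowfam g f *m map_mx intr C.
  rewrite map_mxM -/(boundary_mx rat f) boundary_mxE eE' -!mulmxA -map_mxM PQ.
  by rewrite map_mx1 mulmx1.
have fE : incidence_mx f = Cf *m P.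
  have fE' : boundary_mx rat f = map_mx intr (Cf *m P).
    by rewrite map_mxM CfE boundary_mxE eE' mulmxA.
  apply/matrixP => a j; move/matrixP/(_ a j): fE'.
  by rewrite mxE [RHS]mxE => /intr_inj.
have detCf : (\det Cf)%:~R = \det (rowfam g f) * (\det C)%:~R :> rat.
  by rewrite -!det_map_mx CfE det_mulmx.
have detCf0 : \det Cf != 0.
  by rewrite -(intr_eq0 rat) detCf mulf_neq0 ?intr_eq0.
rewrite (torsion_order_det f_inj (erefl V) dim_f fE PQ detCf0).
rewrite (torsion_order_det e_inj imset_e dim_e eE PQ detC).
rewrite !natr_absz !intr_norm expr_div_n !real_normK ?num_real // detCf.
by rewrite exprMn mulfK // expf_neq0 // intr_eq0.
Qed.
End Subfamily.

(** * The Gram determinant as a sum over forests *)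

Section Enlarged.
Variable U : {set cell X}.
Hypothesis UB : U \subset cells X i.+1 :\: V0.
Let P := V0 :|: U.

Let Pd : P \subset cells X i.+1.
Proof. by rewrite subUset V0d (subset_trans UB) ?subsetDl. Qed.

(** The rank lies between those for the forest and for all of X, both equal to [r]; so forests of
    the enlarged complex have [r] cells. *)
Let rank_P : rank_boundaries i (subcomplex i.+1 P) = r.
Proof.
apply/eqP; rewrite eqn_leq; apply/andP; split.
  rewrite -[X in (_ <= X)%N]dim_boundaries; apply/dimvS/limgS/subvP => c /mem_chains cP.
  apply/mem_chains => s; rewrite setTI => sd; apply: cP.
  by rewrite inE negb_and sd orbT.
apply: (dim_boundaries_ge dim_e) => // a.
by rewrite !inE enum_valP /= orbT.
Qed.

Lemma spanning_forest_subcomplex V :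
  spanning_forest i.+1 (subcomplex i.+1 P) V
    = [&& V \subset P, #|V| == r &
          cycles R i.+1 (skeleton i (subcomplex i.+1 P) :|: V) == 0%VS].
Proof. by rewrite /spanning_forest rank_P cells_subcomplex. Qed.

(** In Cauchy-Binet a map that is not injective repeats a row, and an injective one whose image is
    not a forest has dependent rows: both contribute 0. Each forest is the image of exactly r!
    injective maps, and this factor cancels over the rationals. *)
Lemma det_gram_forests :
  \det (\sum_(s in P) (g s)^T *m g s)
    = \sum_(V | spanning_forest i.+1 (subcomplex i.+1 P) V)
        ((torsion_order i (subcomplex i.+1 V))%:R
          / (torsion_order i (subcomplex i.+1 V0))%:R) ^+ 2.
Proof.
apply: (pmulrnI (fact_gt0 r)); rewrite det_sum_gram.
set forest := spanning_forest _ _.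
pose tau (V : {set cell X}) : rat := ((torsion_order i (subcomplex i.+1 V))%:R
  / (torsion_order i (subcomplex i.+1 V0))%:R) ^+ 2.
rewrite -[RHS]/((\sum_(V | forest V) tau V) *+ r`!).
pose im (f : {ffun 'I_r -> cell X}) := (f @: [set: 'I_r]%SET).
have detE f : f \in ffun_on (mem P) -> \det (rowfam g f) ^+ 2
    = if injectiveb f && forest (im f) then tau (im f) else 0.
  move=> /ffun_onP fP; have dimf a : Defs.dim (f a) = i.+1.
    by have /(subsetP Pd) := fP a; rewrite inE => /eqP.
  have [/injectiveP f_inj|/injectivePn[a [b ab fab]]] := boolP (injectiveb f) => /=.
    have imP : im f \subset P by apply/subsetP => s /imsetP[a _ ->]; apply: fP.
    rewrite /forest spanning_forest_subcomplex imP card_imset // cardsT card_ord eqxx /=.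
    rewrite (cycles_eq0_det f_inj dimf).
    by case: (eqVneq (\det _) 0) => [->|/(det_torsion_ratio f_inj dimf) ->];
      rewrite ?expr0n.
  by rewrite (determinant_alternate ab) ?expr0n // => j; rewrite !mxE fab.
rewrite (eq_bigr _ detE) -big_mkcondr /= (partition_big im forest) /=; last first.
  by move=> f /and3P[].
rewrite -sumrMnl; apply: eq_bigr => V forestV.
move: (forestV); rewrite /forest spanning_forest_subcomplex => /and3P[VP /eqP cardV _].
rewrite (eq_bigr (fun=> tau V)) => [|f /andP[_ /eqP -> //]].
rewrite sumr_const; congr (_ *+ _).
rewrite -[r`!]ffactnn -[X in (X ^_ _)%N]cardV -[X in (_ ^_ X)%N]card_ord.
rewrite -card_inj_ffuns_on; apply: eq_card => f.
rewrite !inE /in_mem /=; apply/idP/idP.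
  case/andP => /and3P[_ f_inj _] /eqP <-; apply/andP; split=> //.
  by apply/ffun_onP => a; apply: imset_f; rewrite inE.
case/andP => /ffun_onP fV f_inj.
have imV : im f = V.
  apply/eqP; rewrite eqEcard; apply/andP; split.
    by apply/subsetP => s /imsetP[a _ ->]; apply: fV.
  by rewrite card_imset ?cardsT ?card_ord ?cardV //; apply/injectiveP.
rewrite imV -/(forest V) forestV f_inj eqxx !andbT; apply/forallP => a.
exact: (subsetP VP) (fV a).
Qed.
End Enlarged.

(** The minor is the determinant of [1 + AJ *m A^T]; exchanging the factors makes it a Gram
    determinant of size [r], to which the sum over forests applies. *)
Lemma det_mesh_minor (J : {set 'I_#|cells X i.+1 :\: V0|}) :
  \det (\matrix_(a, b) if a \in J then mesh_matrix i.+1 V0 a b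
                        else (1%:M : 'M_#|cells X i.+1 :\: V0|) a b)
    = \sum_(V | spanning_forest i.+1
                  (subcomplex i.+1 (V0 :|: (enum_val @: J))) V)
        ((torsion_order i (subcomplex i.+1 V))%:R
          / (torsion_order i (subcomplex i.+1 V0))%:R) ^+ 2.
Proof.
set n := #|_| in J *; pose h (a : 'I_n) : cell X := enum_val a.
have hB a : h a \in cells X i.+1 :\: V0 by apply: enum_valP.
have h_inj : injective h by apply: enum_val_inj.
have UB : h @: J \subset cells X i.+1 :\: V0.
  by apply/subsetP => s /imsetP[a _ ->].
rewrite -(det_gram_forests UB).
pose A := \matrix_(a < n, c < r) g (h a) 0 c.
(* Clearing the rows outside [J] in the left factor alone already leaves rows of the identity
   there. *)
pose AJ := \matrix_(a < n, c < r) if a \in J then g (h a) 0 c else 0.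
set M := \matrix_(a, b) _; have -> : M = 1%:M + AJ *m A^T.
  apply/matrixP => a b; rewrite !mxE; case: ifP => aJ.
    rewrite mesh_entry -?/(h _) ?hB // (inj_eq h_inj); congr (_ + _).
    by apply: eq_bigr => c _; rewrite !mxE aJ.
  by rewrite big1 ?addr0 // => c _; rewrite !mxE aJ mul0r.
rewrite det_add1_mulmx; congr (\det _).
(* The cells of [V0] have the standard basis vectors as coordinates, so their part of the Gram sum
   is the identity; the rest comes from [h @: J]. *)
rewrite (bigID (mem V0)) /=; congr (_ + _).
  rewrite (eq_bigl (mem V0)) => [|s]; last by rewrite inE /= andbC; case: (s \in V0).
  rewrite [in RHS]imset_e big_imset /=; last by move=> a b _ _; apply: e_inj.
  rewrite mx1_sum_delta; apply: eq_big => [a|a _]; first by rewrite inE.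
  by rewrite forest_coord_forest trmx_delta mul_delta_mx.
rewrite (eq_bigl (mem (h @: J))) => [|s] /=; last first.
  rewrite inE; have [/(subsetP UB)|_] := boolP (s \in h @: J); last first.
    by rewrite orbF andbN.
  by rewrite inE orbT => /andP[].
rewrite big_imset /=; last by move=> a b _ _; apply: h_inj.
apply/matrixP => c c'; rewrite summxE mxE [RHS]big_mkcond /=; apply: eq_bigr => a _.
rewrite !mxE; case: ifP => _; last by rewrite mulr0.
by rewrite big_ord1 !mxE.
Qed.

End ForestExpansion.

(** * The combinatorial formula for the coefficients *)

Theorem theorem7p1 (R : realType) (X : finite_CW R) (d : nat)
    (V0 : {set cell X}) (d_gt0 : (0 < d)%N)
    (forestV0 : spanning_forest d [set: cell X] V0) :
  #|cells X d :\: V0| = cycle_dim X d /\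
  (forall k : nat, (k <= cycle_dim X d)%N ->
     ratr (char_poly (mesh_matrix d V0))`_(cycle_dim X d - k)
       = (-1) ^+ k * mesh_sigma d k V0
     /\
     mesh_sigma d k V0
       = ratr (\sum_(U : {set cell X}
                       | (U \subset cells X d :\: V0) && (#|U| == k))
               \sum_(V : {set cell X}
                       | spanning_forest d (subcomplex d (V0 :|: U)) V)
                 ((torsion_order d.-1 (subcomplex d V))%:R
                  / (torsion_order d.-1 (subcomplex d V0))%:R) ^+ 2)).
Proof.
case: d d_gt0 forestV0 => // i _ forest; rewrite -(card_cotree_cells forest).
split=> // k kn; have [coefE detE] :=
  (coef_char_poly_eigenvalues (mesh_matrix i.+1 V0) kn,
   coef_char_poly (mesh_matrix i.+1 V0) kn).
split; first exact: coefE.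
(* Up to this sign both sides are the same coefficient, read from the eigenvalues and from the
   principal minors. *)
apply: (@mulfI _ ((-1) ^+ k)); first by rewrite signr_eq0.
rewrite /mesh_sigma -coefE detE rmorphM /= rmorphXn rmorphN1; congr (_ * ratr _).
pose h (J : {set 'I_#|cells X i.+1 :\: V0|}) : {set cell X} := enum_val @: J.
pose h' (U : {set cell X}) : {set 'I_#|cells X i.+1 :\: V0|} := enum_val @^-1: U.
have hK J : h' (h J) = J.
  apply/setP => a; rewrite inE; apply/imsetP/idP => [[b bJ /enum_val_inj ->] //|aJ].
  by exists a.
(* Index sets [J] correspond to sets [U] of cells outside [V0]; only on such [U] is [h'] inverse to
   [h]. *)
rewrite [RHS](reindex_onto h h') /= => [|U /andP[/subsetP UB _]]; last first.
  apply/setP => s; apply/imsetP/idP => [[a]|sU]; first by rewrite inE => aU ->.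
  by exists (enum_rank_in (UB s sU) s); rewrite ?inE enum_rankK_in ?UB.
apply: eq_big => [J|J _]; last exact: det_mesh_minor.
rewrite hK eqxx andbT card_imset; last exact: enum_val_inj.
rewrite (_ : h J \subset _) //; apply/subsetP => s /imsetP[a _ ->].
exact: enum_valP.
Qed.
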